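(* Let $\Omega_u,\Omega_v$ be two grid blocks coupled across an interface $\Gamma$, let $\mathbf w_J=\begin{bmatrix}\mathbf u_J\\\mathbf v_J\end{bmatrix}$, and let $\mathbb D^{tot}_{JL}$ be the total discrete elastic operator including interface penalty terms (SATs), defined by $$\mathbb D^{tot}_{JL}\mathbf w_L=\begin{bmatrix}\mathbf a_J\\\mathbf b_J\end{bmatrix},$$ $$\begin{aligned} \mathbf a_J&=\mathbb D^{\Omega_u}_{IK}(C^u_{IJKL})\mathbf u_L-(\mathcal J^uH^u)^{-1}e^u_\Gamma\mathbb Z_{LJ}\hat JH_\Gamma\boldsymbol\delta_L+\tfrac12(\mathcal J^uH^u)^{-1}(\mathbb T^u_{LJ})^Te^u_\Gamma\hat JH_\Gamma\boldsymbol\delta_L-\tfrac12(\mathcal J^uH^u)^{-1}e^u_\Gamma\hat JH_\Gamma\boldsymbol\sigma_J+\mathbf B^u_J,\\ \mathbf b_J&=\mathbb D^{\Omega_v}_{IK}(C^v_{IJKL})\mathbf v_L+(\mathcal J^vH^v)^{-1}e^v_\Gamma\mathbb Z_{LJ}\hat JH_\Gamma\boldsymbol\delta_L-\tfrac12(\mathcal J^vH^v)^{-1}(\mathbb T^v_{LJ})^Te^v_\Gamma\hat JH_\Gamma\boldsymbol\delta_L-\tfrac12(\mathcal J^vH^v)^{-1}e^v_\Gamma\hat JH_\Gamma\boldsymbol\sigma_J+\mathbf B^v_J, \end{aligned}$$ where $$\boldsymbol\delta_L=(e^u_\Gamma)^T\mathbf u_L-(e^v_\Gamma)^T\mathbf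 v_L,\qquad\boldsymbol\sigma_J=(e^u_\Gamma)^T\mathbb T^u_{JL}\mathbf u_L+(e^v_\Gamma)^T\mathbb T^v_{JL}\mathbf v_L,$$ $$\mathbb Z_{JL}=\beta\,\frac{d}{4h_1}\,\hat J\left(\frac{n^u_IC^u_{IJKL}n^u_K}{\mathcal J^u}+\frac{n^v_IC^v_{IJKL}n^v_K}{\mathcal J^v}\right),\qquad\beta\ge1,$$ and $\mathbf B^u_J,\mathbf B^v_J$ are the outer-boundary terms specified in the context. Then $\mathbb D^{tot}_{JL}$ is self-adjoint, i.e. $$(\boldsymbol\psi_J,\mathbb D^{tot}_{JL}\mathbf w_L)_{\bar\Omega}=(\mathbb D^{tot}_{JL}\boldsymbol\psi_L,\mathbf w_J)_{\bar\Omega}\qquad\text{for all }\boldsymbol\psi_J=\begin{bmatrix}\boldsymbol\phi_J\\\boldsymbol\chi_J\end{bmatrix}\text{ and }\mathbf w_J=\begin{bmatrix}\mathbf u_J\\\mathbf v_J\end{bmatrix},$$ where $(\boldsymbol\psi_J,\mathbf w_J)_{\bar\Omega}=(\boldsymbol\phi_J,\mathbf u_J)_{\Omega_u}+(\boldsymbol\chi_J,\mathbf v_J)_{\Omega_v}$.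
   Context: Conventions. Repeated subscripts $i,j,k,\ell,I,J,K,L$ are summed from $1$ to $d$, also inside bilinear forms, except where ''no sum'' is stated. Boldface symbols are real grid vectors. A spatially variable coefficient is identified with the diagonal matrix of its grid values. Superscripts $u,v$ mark quantities belonging to the blocks $\Omega_u,\Omega_v$. For each block $\Omega\in\{\Omega_u,\Omega_v\}$ the following are defined (superscript $u$ or $v$ suppressed). $\Omega\subset\mathbb R^d$ is the image of the reference cube $\omega=[0,1]^d$ (coordinates $x_i$) under a smooth one-to-one map $X_I=X_I(x_1,\dots,x_d)$. One-dimensional operators. On a grid of $[0,1]$ including both end points, $H_x=\mathrm{diag}(h_1,h_2,\dots,h_2,h_1)$ has positive diagonal entries (proportional to the grid spacing $h$); $e_0=(1,0,\dots,0)^T$, $e_N=(0,\dots,0,1)^T$. The first-derivative summation-by-parts (SBP) operator $D_x\approx\partial_x$ satisfies $H_xD_x=-D_x^TH_x-e_0e_0^T+e_Ne_N^T$. The fully compatible second-derivative SBP operator $D^{FC}_{xx}(b)\approx\partial_x b\,\partial_x$ satisfies $$H_xD^{FC}_{xx}(b)=-D_x^TH_xbD_x-R_{xx}(b)-e_0e_0^TbD_x+e_Ne_N^TbD_x,$$ where $R_{xx}(b)=\sum_\alpha\mathcal D_{x^\alpha}^TB_\alpha(b)\mathcal D_{x^\alpha}$, the matrices $\mathcal D_{x^\alpha}$ do not depend on $b$, and $B_\alpha(b)$ is diagonal with entries $(B_\alpha(b))_r=\sum_s\beta_{\alpha,r,s}b_s$, $\beta_{\alpha,r,s}\ge0$,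 $b_s$ being the value of $b$ at grid point $s$. The same grid spacing (hence the same $h_1$) is used in each coordinate direction and in both blocks. Multi-dimensional operators on $\omega$. $D_i=I\otimes\cdots\otimes D_{x_i}\otimes\cdots\otimes I$ (with $D_{x_i}$ in position $i$); $D^{FC}_{ii}(b)$ (no sum) applies $D^{FC}_{xx}(b)$ along each grid line in direction $i$; $\mathbb D_{ij}(b)=D^{FC}_{ii}(b)$ if $i=j$ and $\mathbb D_{ij}(b)=D_i\,b\,D_j$ if $i\ne j$. $H=H_{x_1}\otimes\cdots\otimes H_{x_d}$. The faces of $\omega$ are $\partial\omega_i^-=\{x_i=0\}$, $\partial\omega_i^+=\{x_i=1\}$; $\mathcal F$ is the set of all $2d$ faces. For $f=\partial\omega_i^\pm$, $e_f^T$ restricts a grid vector to the grid points of $f$, and $H_f=H_{x_1}\otimes\cdots\otimes H_{x_{i-1}}\otimes H_{x_{i+1}}\otimes\cdots\otimes H_{x_d}$. Metric quantities. $F_{Ii}$ are the grid values of (a possibly approximate) transformation gradient $\partial x_i/\partial X_I$, invertible at each grid point; $\mathcal J=\det[(F^{-1})_{iI}]>0$ is the Jacobian determinant (written $\mathcal J$ to distinguish it from the index $J$); $\nu_i$ is the outward unit normal of $\omega$; $\hat J>0$ is the surface area scale factor; $n_I=\hat J^{-1}\mathcal JF_{Ii}\nu_i$ is the outward normal of $\Omega$. The quantities $\nu_i,n_I,\hat J$ are defined face by face: in any expression associated with a face $f$ they take the values belonging to $f$, also at edge and corner points. $D_I=F_{Ii}D_i$. Material. The real stiffness tensor satisfies,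 at each grid point, $C_{IJKL}=C_{KLIJ}$ and $S_{IJ}C_{IJKL}S_{KL}\ge0$ for all $S_{IJ}$. The transformed stiffness tensor is $c_{iJkL}=F_{Ii}\,\mathcal J\,C_{IJKL}F_{Kk}$. Define $$\mathbb D^\Omega_{IK}(C_{IJKL})=\mathcal J^{-1}\mathbb D_{ik}(c_{iJkL}),\qquad \mathbb T_{JL}=n_IC_{IJKL}D_K .$$ The discrete volume integral is $(\mathbf a,\mathbf b)_\Omega=\mathbf a^T\mathcal JH\mathbf b$. Interface. $\Gamma$ is a full face of each block; the grid points of the two blocks on $\Gamma$ coincide, the face quadrature $H_\Gamma$ and the scale factor $\hat J$ on $\Gamma$ are the same from both sides, and $(e^u_\Gamma)^T$, $(e^v_\Gamma)^T$ restrict grid vectors of each block to the points of $\Gamma$. On $\Gamma$, $\mathbb T^{u}_{JL},\mathbb T^{v}_{JL}$ are formed with the normals $n^u,n^v$ to $\Gamma$ outward from the respective block, and $\mathbb Z_{JL}$ is a diagonal matrix of grid values on $\Gamma$. The material parameters, $F_{Ii}$ and $\mathcal J$ may be discontinuous across $\Gamma$. Outer boundaries. Outer-boundary terms are disregarded in the analysis: $\mathbf B^u_J,\mathbf B^v_J$ are the penalty terms that exactly remove the outer-boundary contributions (those of homogeneous traction conditions), $\mathbf B^u_J=-(\mathcal J^uH^u)^{-1}\sum_{f\in\mathcal F^u,\,f\ne\Gamma}e_f\hat JH_fe_f^T\mathbb T^u_{JL}\mathbf u_L$, and analogously $\mathbf B^v_J$. *)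

(* Defs.v *)
From HB Require Import structures.
From mathcomp Require Import all_boot all_order all_algebra.

Set Implicit Arguments.
Unset Strict Implicit.
Unset Printing Implicit Defensive.

Import Order.TTheory GRing.Theory Num.Theory.
Local Open Scope ring_scope.

(* The grid of [0,1] has N.+1 points s / N, s = 0, .., N, so both end points
   are grid points, with N > 0 required where the operators are used.  A
   coefficient b on this grid is a row vector, and its diagonal matrix is
   diag_mx b. *)
Section OneDimensional.
Variables (R : realFieldType) (N : nat).

Definition e_first : 'cV[R]_N.+1 := delta_mx ord0 0.
Definition e_last : 'cV[R]_N.+1 := delta_mx ord_max 0.

(* First-derivative SBP operator together with the fully compatible
   second-derivative operator b |-> sbp_FC b (approximating d/dx b d/dx).
   sbp_h is the diagonal of H_x; it reads (h_1, h_2, .., h_2, h_1), i.e. it is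
   symmetric about the midpoint of the grid.  The index alpha of the remainder
   R_xx(b) ranges over 'I_sbp_m, and the matrix sbp_cD alpha, which may have
   any number of rows, does not depend on b. *)
Record sbp1d := Sbp1d {
  sbp_h : 'rV[R]_N.+1;
  sbp_D : 'M[R]_N.+1;
  sbp_FC : 'rV[R]_N.+1 -> 'M[R]_N.+1;
  sbp_m : nat;
  sbp_q : 'I_sbp_m -> nat;
  sbp_cD : forall a : 'I_sbp_m, 'M[R]_(sbp_q a, N.+1);
  sbp_beta : forall a : 'I_sbp_m, 'M[R]_(sbp_q a, N.+1);
  sbp_H : 'M[R]_N.+1 := diag_mx sbp_h;
  sbp_B : forall a : 'I_sbp_m, 'rV[R]_N.+1 -> 'M[R]_(sbp_q a) := fun a b =>
    diag_mx (\row_r \sum_(s < N.+1) sbp_beta a r s * b 0 s);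
  sbp_R : 'rV[R]_N.+1 -> 'M[R]_N.+1 := fun b =>
    \sum_(a < sbp_m) (sbp_cD a)^T *m sbp_B a b *m sbp_cD a;
  sbp_h_gt0 : forall s, 0 < sbp_h 0 s;
  sbp_h_rev : forall s, sbp_h 0 (rev_ord s) = sbp_h 0 s;
  sbp_beta_ge0 : forall a r s, 0 <= sbp_beta a r s;
  sbp_D_eq :
    sbp_H *m sbp_D =
      - (sbp_D^T *m sbp_H) - e_first *m e_first^T + e_last *m e_last^T;
  sbp_FC_eq : forall b,
    sbp_H *m sbp_FC b =
      - (sbp_D^T *m sbp_H *m diag_mx b *m sbp_D) - sbp_R b
      - e_first *m e_first^T *m diag_mx b *m sbp_D
      + e_last *m e_last^T *m diag_mx b *m sbp_D
}.

End OneDimensional.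

(* The multi-index p of a grid point of [0,1]^d. *)
Definition grid (d N : nat) : finType := {ffun 'I_d -> 'I_N.+1}.

(* (i, false) is the face x_i = 0 and (i, true) is the face x_i = 1. *)
Definition face (d : nat) : finType := ('I_d * bool)%type.

Definition on_face (d N : nat) (f : face d) (p : grid d N) : bool :=
  p f.1 == (if f.2 then ord_max else ord0).

Definition face_pt (d N : nat) (f : face d) : finType :=
  {p : grid d N | on_face f p}.

Definition nu (R : realFieldType) (d : nat) (f : face d) (i : 'I_d) : R :=
  if i == f.1 then (if f.2 then 1 else - 1) else 0.

(* Grid vectors on a finite set P of points are column vectors of length #|P|,
   entry s being the value at the point enum_val s. *)
Section GridMatrices.
Variable R : realFieldType.

Definition gdiag (P : finType) (b : P -> R) : 'M[R]_#|P| :=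
  diag_mx (\row_s b (enum_val s)).

(* The restriction u |-> u \o g of grid vectors on Q to grid vectors on P. *)
Definition restr (P Q : finType) (g : P -> Q) : 'M[R]_(#|P|, #|Q|) :=
  \matrix_(s, q) (g (enum_val s) == enum_val q)%:R.

(* The Kronecker product of A 0, .., A d.-1, up to the numbering of the grid
   points. *)
Definition kron (d N : nat) (A : 'I_d -> 'M[R]_N.+1) : 'M[R]_#|grid d N| :=
  \matrix_(p, q) \prod_(j < d) A j ((enum_val p : grid d N) j) ((enum_val q : grid d N) j).

(* The s-th point of the grid line through p in direction i. *)
Definition line_pt (d N : nat) (p : grid d N) (i : 'I_d) (s : 'I_N.+1) :
    grid d N :=
  [ffun j => if j == i then s else p j].

End GridMatrices.

(* blk_X holds the positions of the grid points under the one-to-one map from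
   the reference cube to the block.  blk_F p I i is the value of F_{Ii} at p; it
   is not tied to blk_X, as the transformation gradient may be approximate.
   blk_Jhat f is the surface area scale factor of the face f, an arbitrary
   positive function (in particular it may be the norm of J F_{Ii} nu_i, which
   makes the normal a unit vector); only its values at the points of f are
   meaningful. *)
Record block (R : realFieldType) (d N : nat) := Block {
  blk_sbp : 'I_d -> sbp1d R N;
  blk_X : grid d N -> 'rV[R]_d;
  blk_F : grid d N -> 'M[R]_d;
  blk_Jhat : face d -> grid d N -> R;
  blk_C : 'I_d -> 'I_d -> 'I_d -> 'I_d -> grid d N -> R;
  blk_J : grid d N -> R := fun p => \det (invmx (blk_F p));
  blk_X_inj : injective blk_X;
  blk_F_unit : forall p, blk_F p \in unitmx;
  blk_J_gt0 : forall p, 0 < blk_J p;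
  blk_Jhat_gt0 : forall f p, on_face f p -> 0 < blk_Jhat f p;
  blk_C_sym : forall I J K L p, blk_C I J K L p = blk_C K L I J p;
  blk_C_psd : forall p (S : 'M[R]_d),
    0 <= \sum_I \sum_J \sum_K \sum_L S I J * blk_C I J K L p * S K L
}.

Section BlockOperators.
Variables (R : realFieldType) (d N : nat) (B : block R d N).
Local Notation G := (grid d N).
Local Notation sbp := (blk_sbp B).

Definition Hvol : 'M[R]_#|G| := kron (fun j => sbp_H (sbp j)).

Definition D1 (i : 'I_d) : 'M[R]_#|G| :=
  kron (fun j => if j == i then sbp_D (sbp j) else 1%:M).

Definition DFC (i : 'I_d) (b : G -> R) : 'M[R]_#|G| :=
  \matrix_(r, t)
    let p : G := enum_val r in let q : G := enum_val t in
    if [forall (j | j != i), p j == q j]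
    then sbp_FC (sbp i) (\row_s b (line_pt p i s)) (p i) (q i)
    else 0.

Definition DD (i j : 'I_d) (b : G -> R) : 'M[R]_#|G| :=
  if i == j then DFC i b else D1 i *m gdiag b *m D1 j.

(* The diagonal matrix H_f; its entry at p is the product of the
   one-dimensional weights in the directions tangential to f. *)
Definition Hface_pt (f : face d) (s : face_pt N f) : R :=
  \prod_(j < d | j != f.1) sbp_h (sbp j) 0 (val s j).

Definition Hface (f : face d) : 'M[R]_#|face_pt N f| := gdiag (@Hface_pt f).

Definition Jhat_face (f : face d) : 'M[R]_#|face_pt N f| :=
  gdiag (fun s : face_pt N f => blk_Jhat B f (val s)).

(* The matrix e_f^T. *)
Definition eT (f : face d) : 'M[R]_(#|face_pt N f|, #|G|) :=
  restr R (fun s : face_pt N f => val s).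

Definition normal (f : face d) (I : 'I_d) (p : G) : R :=
  (blk_Jhat B f p)^-1 * blk_J B p * \sum_i blk_F B p I i * nu R f i.

Definition Dphys (I : 'I_d) : 'M[R]_#|G| :=
  \sum_i gdiag (fun p => blk_F B p I i) *m D1 i.

Definition cref (i J k L : 'I_d) (p : G) : R :=
  \sum_I \sum_K blk_F B p I i * blk_J B p * blk_C B I J K L p * blk_F B p K k.

(* D^Omega_{IK}(C_{IJKL}), summed over I and K. *)
Definition Dvol (J L : 'I_d) : 'M[R]_#|G| :=
  \sum_i \sum_k gdiag (fun p => (blk_J B p)^-1) *m DD i k (cref i J k L).

(* T_{JL} formed with the normal to the face f.  Its rows at grid points
   outside f are meaningless, and it only occurs in the products
   e_f^T T_{JL} and T_{JL}^T e_f, which do not involve them. *)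
Definition Trac (f : face d) (J L : 'I_d) : 'M[R]_#|G| :=
  \sum_I \sum_K
    gdiag (fun p => normal f I p * blk_C B I J K L p) *m Dphys K.

Definition JHinv : 'M[R]_#|G| := invmx (gdiag (blk_J B) *m Hvol).

Definition outer_pen (gam : face d) (u : 'I_d -> 'cV[R]_#|G|) (J : 'I_d) :
    'cV[R]_#|G| :=
  - (JHinv *m \sum_(f : face d | f != gam) \sum_L
       (eT f)^T *m Jhat_face f *m Hface f *m eT f *m Trac f J L *m u L).

Definition ip (a b : 'cV[R]_#|G|) : R :=
  (a^T *m gdiag (blk_J B) *m Hvol *m b) 0 0.

End BlockOperators.

(* The interface is the face ifc_u of the block Bu and the face ifc_v of the
   block Bv.  ifc_pt maps a grid point of ifc_u to the grid point of ifc_v at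
   the same position; in terms of multi-indices it may permute or reverse
   coordinate directions.  Grid vectors on the interface are indexed by the grid
   points of ifc_u. *)
Record interface (R : realFieldType) (d N : nat) (Bu Bv : block R d N) :=
  Interface {
  ifc_u : face d;
  ifc_v : face d;
  ifc_pt : face_pt N ifc_u -> face_pt N ifc_v;
  ifc_pt_bij : bijective ifc_pt;
  ifc_X : forall s, blk_X Bu (val s) = blk_X Bv (val (ifc_pt s));
  ifc_H : forall s, Hface_pt Bu s = Hface_pt Bv (ifc_pt s);
  ifc_Jhat : forall s,
    blk_Jhat Bu ifc_u (val s) = blk_Jhat Bv ifc_v (val (ifc_pt s))
}.

Section Coupled.
Variables (R : realFieldType) (d N : nat) (Bu Bv : block R d N).
Variable (Gam : interface Bu Bv).
Local Notation G := (grid d N).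
Local Notation P := (face_pt N (ifc_u Gam)).
Local Notation gu := (ifc_u Gam).
Local Notation gv := (ifc_v Gam).

Definition euT : 'M[R]_(#|P|, #|G|) := eT R N gu.
Definition evT : 'M[R]_(#|P|, #|G|) :=
  restr R (fun s : P => val (ifc_pt s)).

Definition Hgam : 'M[R]_#|P| := Hface Bu gu.
Definition Jhat_gam : 'M[R]_#|P| := Jhat_face Bu gu.

(* n_I C_{IJKL} n_K / J at a point of the face f. *)
Definition nCn (B : block R d N) (f : face d) (J L : 'I_d) (p : G) : R :=
  (\sum_I \sum_K normal B f I p * blk_C B I J K L p * normal B f K p)
  / blk_J B p.

Definition Zpen (h1 beta : R) (J L : 'I_d) : 'M[R]_#|P| :=
  gdiag (fun s : P =>
    beta * (d%:R / (4 * h1)) * blk_Jhat Bu gu (val s) *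
    (nCn Bu gu J L (val s) + nCn Bv gv J L (val (ifc_pt s)))).

Section Action.
Variables (h1 beta : R) (u v : 'I_d -> 'cV[R]_#|G|).

Definition jump (L : 'I_d) : 'cV[R]_#|P| := euT *m u L - evT *m v L.

Definition trac_sum (J : 'I_d) : 'cV[R]_#|P| :=
  \sum_L (euT *m Trac Bu gu J L *m u L + evT *m Trac Bv gv J L *m v L).

Definition Dtot_u (J : 'I_d) : 'cV[R]_#|G| :=
  (\sum_L Dvol Bu J L *m u L)
  - (\sum_L JHinv Bu *m euT^T *m Zpen h1 beta L J *m Jhat_gam *m Hgam
       *m jump L)
  + 2^-1 *: (\sum_L JHinv Bu *m (Trac Bu gu L J)^T *m euT^T *m Jhat_gam
       *m Hgam *m jump L)
  - 2^-1 *: (JHinv Bu *m euT^T *m Jhat_gam *m Hgam *m trac_sum J)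
  + outer_pen Bu gu u J.

Definition Dtot_v (J : 'I_d) : 'cV[R]_#|G| :=
  (\sum_L Dvol Bv J L *m v L)
  + (\sum_L JHinv Bv *m evT^T *m Zpen h1 beta L J *m Jhat_gam *m Hgam
       *m jump L)
  - 2^-1 *: (\sum_L JHinv Bv *m (Trac Bv gv L J)^T *m evT^T *m Jhat_gam
       *m Hgam *m jump L)
  - 2^-1 *: (JHinv Bv *m evT^T *m Jhat_gam *m Hgam *m trac_sum J)
  + outer_pen Bv gv v J.

End Action.

(* J |-> D^tot_{JL} w_L for the stacked vectors w_J = [u_J; v_J]. *)
Definition Dtot (h1 beta : R) (w : 'I_d -> 'cV[R]_(#|G| + #|G|)) (J : 'I_d) :
    'cV[R]_(#|G| + #|G|) :=
  let u L := usubmx (w L) in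
  let v L := dsubmx (w L) in
  col_mx (Dtot_u h1 beta u v J) (Dtot_v h1 beta u v J).

End Coupled.

Definition ip_tot (R : realFieldType) (d N : nat) (Bu Bv : block R d N)
    (psi w : 'I_d -> 'cV[R]_(#|grid d N| + #|grid d N|)) : R :=
  \sum_J ip Bu (usubmx (psi J)) (usubmx (w J))
  + \sum_J ip Bv (dsubmx (psi J)) (dsubmx (w J)).

(* Main.v *)
(* Multiplied by J H, the volume operator D^Omega_{IK}(C_{IJKL}) of one block
   becomes -S_{JL} plus e_f Jhat H_f e_f^T T_{JL} summed over the faces f, where
   S_{JL}^T = S_{LJ} by the major symmetry of C.  The outer-boundary terms cancel
   all faces but the interface.  With tau = e^T T u on either side, delta the jump
   of the second argument and delta' that of the first, the two blocks together
   leave on the interface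
     - <delta'_J, Z_{LJ} delta_L>
     + 1/2 <tau'^u_J - tau'^v_J, delta_J> + 1/2 <delta'_J, tau^u_J - tau^v_J>,
   which is symmetric because Z_{JL} = Z_{LJ}. *)
Require Import Defs.
From mathcomp Require Import all_boot all_order all_algebra.
From mathcomp Require Import ring.

Set Implicit Arguments.
Unset Strict Implicit.
Unset Printing Implicit Defensive.

Import Order.TTheory GRing.Theory Num.Theory.
Local Open Scope ring_scope.

(** * Diagonal matrices of grid values and restrictions to point sets *)

Section GridDiag.
Context {R : realFieldType}.
Implicit Types P Q : finType.

Lemma gdiagE P (b : P -> R) s t :
  gdiag b s t = b (enum_val s) *+ (s == t).
Proof. by rewrite !mxE. Qed.

Lemma eq_gdiag P (a b : P -> R) : a =1 b -> gdiag a = gdiag b.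
Proof. by move=> ab; apply/matrixP=> s t; rewrite !gdiagE ab. Qed.

Lemma tr_gdiag P (b : P -> R) : (gdiag b)^T = gdiag b.
Proof. exact: tr_diag_mx. Qed.

Lemma mul_gdiag P (a b : P -> R) :
  gdiag a *m gdiag b = gdiag (fun p => a p * b p).
Proof.
by rewrite /gdiag mulmx_diag; congr diag_mx; apply/rowP=> s; rewrite !mxE.
Qed.

Lemma sum_gdiag P (I : finType) (b : I -> P -> R) :
  \sum_i gdiag (b i) = gdiag (fun p => \sum_i b i p).
Proof.
apply/matrixP=> s t; rewrite summxE gdiagE -sumrMnl.
by apply: eq_bigr => i _; rewrite gdiagE.
Qed.

Lemma gdiag_unit P (b : P -> R) : (forall p, 0 < b p) -> gdiag b \in unitmx.
Proof.
move=> b_gt0; rewrite unitmxE det_diag unitfE; apply/prodf_neq0=> s _.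
by rewrite mxE lt0r_neq0.
Qed.

Lemma sum_enum_val P (F : P -> R) :
  \sum_(s < #|P|) F (enum_val s) = \sum_p F p.
Proof.
rewrite [RHS](reindex (@enum_val P P)) //=.
by exists (@enum_rank P) => s _; rewrite ?enum_valK ?enum_rankK.
Qed.

Lemma mul_gdiag_mx P n (b : P -> R) (A : 'M[R]_(#|P|, n)) s j :
  (gdiag b *m A) s j = b (enum_val s) * A s j.
Proof. by rewrite mul_diag_mx !mxE. Qed.

(** A quadrature on [P] pulled back to [Q] stays diagonal, since a row of [restr R g] has a single
    nonzero entry. Stated for any [g], it serves both the inclusion of a face and the matching of
    interface points. *)
Lemma restr_gdiag P Q (g : P -> Q) (a : P -> R) :
  (restr R g)^T *m gdiag a *m restr R g =
  gdiag (fun q => \sum_(s | g s == q) a s).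
Proof.
apply/matrixP=> q r; rewrite gdiagE -mulmxA mxE.
under eq_bigr do rewrite mul_gdiag_mx !mxE.
rewrite (sum_enum_val (fun s => (g s == enum_val q)%:R *
  (a s * (g s == enum_val r)%:R))).
rewrite -sumrMnl [RHS]big_mkcond /=; apply: eq_bigr => s _.
have [->|_] := eqVneq; last by rewrite mul0r.
by rewrite (inj_eq enum_val_inj) mul1r mulr_natr.
Qed.
End GridDiag.

(** * Matrices acting along the grid lines in direction [i] *)

Section LineOperators.
Context {R : realFieldType} {d N : nat} (i : 'I_d).
Local Notation G := (grid d N).
Implicit Types (M : G -> 'M[R]_N.+1) (p q r : G).

Definition same_line p q := [forall (j | j != i), p j == q j].

(** Lines are represented by any of their points, so data attached to a line is a function on [G]
    that must not depend on the chosen representative. *)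
Definition line_inv (T : Type) (M : G -> T) :=
  forall p q, same_line p q -> M p = M q.

(* H, D_i, D_ii^FC(b), R_ii(b) and every diagonal matrix have this form, so that
   the one-dimensional SBP identities lift to the grid line by line. *)
Definition line_mx M : 'M[R]_#|G| :=
  \matrix_(s, t) let p := enum_val s : G in let q := enum_val t : G in
    if same_line p q then M p (p i) (q i) else 0.

Lemma same_lineP p q :
  reflect (forall j, j != i -> p j = q j) (same_line p q).
Proof. by apply: (iffP 'forall_in_eqP). Qed.

Lemma same_line_sym p q : same_line p q = same_line q p.
Proof.
by apply/same_lineP/same_lineP=> pq j ji; rewrite pq.
Qed.

Lemma same_line_trans p q r :
  same_line p q -> same_line p r = same_line q r.
Proof.
move/same_lineP=> pq; apply/same_lineP/same_lineP=> h j ji.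
  by rewrite -pq // h.
by rewrite pq // h.
Qed.

Lemma same_line_eq p q : same_line p q -> (p == q) = (p i == q i).
Proof.
move/same_lineP=> pq; apply/eqP/eqP=> [->//|pqi].
by apply/ffunP=> j; have [->|/pq] := eqVneq j i.
Qed.

Lemma line_pt_inv (b : G -> R) : line_inv (fun p => \row_s b (line_pt p i s)).
Proof.
move=> p q /same_lineP pq; apply/rowP=> s; rewrite !mxE.
by congr b; apply/ffunP=> j; rewrite !ffunE; case: eqVneq => // /pq.
Qed.

Lemma line_pt_id p : line_pt p i (p i) = p.
Proof. by apply/ffunP=> j; rewrite ffunE; case: eqVneq => // ->. Qed.

Lemma sum_line p (F : G -> R) :
  \sum_(r | same_line p r) F r = \sum_s F (line_pt p i s).
Proof.
rewrite (reindex_onto (line_pt p i) (fun r => r i)) /=; last first.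
  move=> r /same_lineP pr; apply/ffunP=> j.
  by rewrite ffunE; case: eqVneq => [->//|/pr].
apply: eq_bigl => s; rewrite ffunE !eqxx andbT.
by apply/same_lineP=> j /negbTE ji; rewrite ffunE ji.
Qed.

Lemma eq_line_mx M M' : M =1 M' -> line_mx M = line_mx M'.
Proof. by move=> MM'; apply/matrixP=> s t; rewrite !mxE /= MM'. Qed.

(** Only intermediate points on the line of [p] contribute. There [M'] is evaluated at the
    intermediate point, hence the invariance of [M']; [M] is already taken at [p]. *)
Lemma mul_line_mx M M' : line_inv M' ->
  line_mx M *m line_mx M' = line_mx (fun p => M p *m M' p).
Proof.
move=> M'inv; apply/matrixP=> s t; rewrite !mxE /=.
set p := enum_val s; set q := enum_val t.
under eq_bigr do rewrite !mxE /=.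
rewrite (sum_enum_val (fun r => (if same_line p r then M p (p i) (r i) else 0)
  * (if same_line r q then M' r (r i) (q i) else 0))).
rewrite (bigID (same_line p)) /= [X in _ + X]big1 => [|r /negbTE ->]; last first.
  by rewrite mul0r.
rewrite addr0.
under eq_bigr => r pr do
  rewrite pr -(same_line_trans _ pr) -(M'inv _ _ pr).
rewrite sum_line; have [pq|_] := boolP (same_line p q); last first.
  by rewrite big1 // => u _; rewrite mulr0.
by rewrite mxE; apply: eq_bigr => u _; rewrite ffunE eqxx.
Qed.

Lemma tr_line_mx M : line_inv M ->
  (line_mx M)^T = line_mx (fun p => (M p)^T).
Proof.
move=> Minv; apply/matrixP=> s t; rewrite !mxE /= same_line_sym.
by case: ifP => // pq; rewrite mxE (Minv _ _ pq).
Qed.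

Lemma line_mxD M M' :
  line_mx (fun p => M p + M' p) = line_mx M + line_mx M'.
Proof.
by apply/matrixP=> s t; rewrite !mxE /=; case: ifP; rewrite ?addr0 // mxE.
Qed.

Lemma line_mxN M : line_mx (fun p => - M p) = - line_mx M.
Proof.
by apply/matrixP=> s t; rewrite !mxE /=; case: ifP; rewrite ?oppr0 // mxE.
Qed.

Lemma gdiag_line (b : G -> R) :
  gdiag b = line_mx (fun p => diag_mx (\row_s b (line_pt p i s))).
Proof.
apply/matrixP=> s t; rewrite gdiagE !mxE /=; case: ifP => pq.
  rewrite -(inj_eq enum_val_inj) (same_line_eq pq).
  by rewrite !mxE line_pt_id.
by case: eqVneq => // st; rewrite st in pq; case/same_lineP: pq.
Qed.

End LineOperators.

(** * Summation by parts for the multi-dimensional operators *)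

Section SummationByParts.
Context {R : realFieldType} {d N : nat} (B : block R d N).
Local Notation G := (grid d N).
Local Notation sbp := (blk_sbp B).
Implicit Types (i k : 'I_d) (b : G -> R) (p : G).

(** The face quadrature of both faces normal to direction [i], extended to all grid points so that
    it is constant along lines. *)
Definition tan_weight i p : R := \prod_(j < d | j != i) sbp_h (sbp j) 0 (p j).

(** The diagonal of the tangential quadrature tensored with $e_Ne_N^T-e_0e_0^T$ in direction [i]. *)
Definition bnd_weight i p : R :=
  tan_weight i p * ((p i == ord_max)%:R - (p i == ord0)%:R).

Definition Rem i b : 'M[R]_#|G| :=
  line_mx i (fun p =>
    tan_weight i p *: sbp_R (sbp i) (\row_s b (line_pt p i s))).

(* The volume part of - H D_{ik}(b). *)
Definition stiff i k b : 'M[R]_#|G| :=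
  (D1 B i)^T *m Hvol B *m gdiag b *m D1 B k + (if i == k then Rem i b else 0).

Lemma tan_weight_inv i : line_inv i (tan_weight i).
Proof.
by move=> p q /same_lineP pq; apply: eq_bigr => j /pq ->.
Qed.

Lemma Hvol_gdiag : Hvol B = gdiag (fun p => \prod_j sbp_h (sbp j) 0 (p j)).
Proof.
apply/matrixP=> s t; rewrite gdiagE mxE.
have [->|st] := eqVneq s t.
  by apply: eq_bigr => j _; rewrite mxE eqxx.
have /eqP/ffunP : enum_val s != enum_val t by rewrite (inj_eq enum_val_inj).
move=> /eqfunP; rewrite negb_forall => /existsP[j pq].
by rewrite mulr0n (bigD1 j) //= mxE (negbTE pq) mul0r.
Qed.

Lemma Hvol_line i : Hvol B = line_mx i (fun p => tan_weight i p *: sbp_H (sbp i)).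
Proof.
rewrite Hvol_gdiag (gdiag_line i); apply: eq_line_mx => p.
rewrite /sbp_H -linearZ; congr diag_mx; apply/rowP=> s; rewrite !mxE.
rewrite (bigD1 i) //= mulrC ffunE eqxx; congr (_ * _).
by apply: eq_bigr => j /negbTE ji; rewrite ffunE ji.
Qed.

Lemma D1_line i : D1 B i = line_mx i (fun=> sbp_D (sbp i)).
Proof.
apply/matrixP=> s t; rewrite !mxE /= (bigD1 i) //= eqxx.
case: ifPn => [/same_lineP pq|].
  rewrite big1 ?mulr1 // => j /[dup] ji /negbTE->.
  by rewrite mxE pq ?eqxx.
rewrite negb_forall_in => /exists_inP[j ji pq].
by rewrite (bigD1 j) //= (negbTE ji) mxE (negbTE pq) mul0r mulr0.
Qed.

Lemma bnd_weight_line i :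
  gdiag (bnd_weight i) = line_mx i (fun p => tan_weight i p *:
    (- (e_first R N *m (e_first R N)^T) + e_last R N *m (e_last R N)^T)).
Proof.
rewrite (gdiag_line i); apply/matrixP=> s t; rewrite !mxE /=.
case: ifP => // pq; rewrite !mxE !big_ord1 !mxE !eqxx !andbT.
rewrite /bnd_weight line_pt_id.
set x := (enum_val s : G) i; set y := (enum_val t : G) i.
(* The end-point projectors $e_0e_0^T$ and $e_Ne_N^T$ have no off-diagonal entries. *)
have xyc c : (x == c)%:R * (y == c)%:R = (x == c)%:R *+ (x == y) :> R.
  by have [->|] := eqVneq x c; rewrite ?mul0r ?mul0rn // mul1r eq_sym.
by rewrite !xyc [in RHS]addrC -mulrnBl mulrnAr.
Qed.

Lemma Hvol_D1 i :
  Hvol B *m D1 B i = - ((D1 B i)^T *m Hvol B) + gdiag (bnd_weight i).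
Proof.
rewrite D1_line bnd_weight_line (Hvol_line i) tr_line_mx //.
rewrite !mul_line_mx //; last first.
  by move=> p q pq; rewrite (tan_weight_inv pq).
rewrite -line_mxN -line_mxD; apply: eq_line_mx => p.
by rewrite -scalemxAl sbp_D_eq -scalemxAr -scalerN -scalerDr addrA.
Qed.

Lemma Hvol_DFC i b :
  Hvol B *m DFC B i b =
    - ((D1 B i)^T *m Hvol B *m gdiag b *m D1 B i) - Rem i b
    + gdiag (bnd_weight i) *m gdiag b *m D1 B i.
Proof.
have hinv : line_inv i (fun p => tan_weight i p *: sbp_H (sbp i)).
  by move=> p q pq; rewrite (tan_weight_inv pq).
have binv : line_inv i (fun p => diag_mx (\row_s b (line_pt p i s))).
  by move=> p q pq; rewrite (line_pt_inv b pq).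
rewrite D1_line bnd_weight_line (Hvol_line i) (gdiag_line i b) tr_line_mx //.
(* [DFC] unfolds to a line matrix, so the one-dimensional identity can be used on each line with its
   own coefficient. *)
rewrite -[DFC B i b]/(line_mx i (fun p =>
  sbp_FC (sbp i) (\row_s b (line_pt p i s)))).
rewrite !mul_line_mx //; last first.
  by move=> p q pq; rewrite (line_pt_inv b pq).
rewrite -!line_mxN -!line_mxD; apply: eq_line_mx => p.
rewrite -scalemxAr -!scalemxAl -!scalerN -!scalerDr sbp_FC_eq.
by rewrite !mulmxDl !mulNmx !addrA.
Qed.

(** Full compatibility makes the boundary term of the diagonal case contain the same [D1] as the
    mixed case, so both cases have one formula and differ only by the remainder inside [stiff]. *)
Lemma Hvol_DD i k b :
  Hvol B *m DD B i k b =
    - stiff i k b + gdiag (bnd_weight i) *m gdiag b *m D1 B k.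
Proof.
rewrite /DD /stiff; case: eqVneq => [<-|_].
  by rewrite Hvol_DFC opprD.
by rewrite addr0 !mulmxA Hvol_D1 !mulmxDl !mulNmx.
Qed.

Lemma tr_sbp_R (O : sbp1d R N) (c : 'rV_N.+1) : (sbp_R O c)^T = sbp_R O c.
Proof.
rewrite /sbp_R linear_sum; apply: eq_bigr => a _ /=.
by rewrite !trmx_mul trmxK tr_diag_mx mulmxA.
Qed.

Lemma tr_Rem i b : (Rem i b)^T = Rem i b.
Proof.
rewrite /Rem tr_line_mx; last first.
  by move=> p q pq; rewrite (tan_weight_inv pq) (line_pt_inv b pq).
by apply: eq_line_mx => p; rewrite linearZ /= tr_sbp_R.
Qed.

(** The diagonal matrices of $H$ and $b$ commute, and the remainder, present only for equal indices,
    is symmetric because each $B_\alpha$ is diagonal. *)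
Lemma tr_stiff i k b : (stiff i k b)^T = stiff k i b.
Proof.
rewrite /stiff linearD /= eq_sym !trmx_mul trmxK Hvol_gdiag !tr_gdiag.
congr (_ + _).
  rewrite !mulmxA -!(mulmxA (D1 B k)^T (gdiag _) (gdiag _)) !mul_gdiag.
  by congr (_ *m _ *m _); apply: eq_gdiag => p; rewrite mulrC.
by case: eqVneq => [->|_]; rewrite ?trmx0 ?tr_Rem.
Qed.

Lemma eq_stiff i k b c : b =1 c -> stiff i k b = stiff i k c.
Proof.
move=> bc; rewrite /stiff (eq_gdiag bc); case: eqP => // _; congr (_ + _).
by apply: eq_line_mx => p; congr (_ *: sbp_R _ _); apply/rowP=> s; rewrite !mxE bc.
Qed.

End SummationByParts.

(** * Discrete Green formula on one block *)

Section GreenFormula.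
Context {R : realFieldType} {d N : nat} (B : block R d N).
Local Notation G := (grid d N).
Implicit Types (i k J L : 'I_d) (f : face d) (p : G).

Definition face_mass f : 'M[R]_#|G| :=
  (eT R N f)^T *m Jhat_face B f *m Hface B f *m eT R N f.

Definition stiff_tot J L : 'M[R]_#|G| :=
  \sum_i \sum_k stiff B i k (cref B i J k L).

Lemma face_massE f :
  face_mass f = gdiag (fun p =>
    if on_face f p then blk_Jhat B f p * tan_weight B f.1 p else 0).
Proof.
rewrite /face_mass -!mulmxA (mulmxA (Jhat_face B f)) mul_gdiag mulmxA.
rewrite restr_gdiag; apply: eq_gdiag => p.
case: ifPn => fp.
  by rewrite (big_pred1 (Sub p fp)).
rewrite big_pred0 // => s; apply: contraNF fp => /eqP <-.
exact: valP s.
Qed.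

(** Only the two faces normal to direction [i] have $\nu_i\ne0$, and their signs are those of the
    end-point terms. Edge and corner points are counted once for each face containing them. *)
Lemma bnd_weight_faces i p :
  bnd_weight B i p =
  \sum_f nu R f i * (if on_face f p then tan_weight B f.1 p else 0).
Proof.
rewrite -(pair_bigA _ (fun j (c : bool) => nu R (j, c) i *
  (if on_face (j, c) p then tan_weight B j p else 0))) /=.
rewrite (bigD1 i) //= big_bool big1 => [|j ji]; last first.
  by rewrite big1 // => c _; rewrite /nu /= eq_sym (negbTE ji) mul0r.
rewrite /nu /on_face /= eqxx /bnd_weight addr0.
by case: (p i == ord_max); case: (p i == ord0) => /=; ring.
Qed.

Lemma Trac_gdiag f J L :
  Trac B f J L = \sum_k gdiag (fun p => \sum_I \sum_K
    normal B f I p * blk_C B I J K L p * blk_F B p K k) *m D1 B k.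
Proof.
rewrite /Trac /Dphys.
under eq_bigr do under eq_bigr do rewrite mulmx_sumr.
under eq_bigr do rewrite exchange_big.
rewrite exchange_big; apply: eq_bigr => k _ /=.
rewrite -sum_gdiag mulmx_suml; apply: eq_bigr => I _.
rewrite -sum_gdiag mulmx_suml; apply: eq_bigr => K _.
by rewrite mulmxA mul_gdiag.
Qed.

(** Discrete Nanson relation $\hat Jn_I=\mathcal JF_{Ii}\nu_i$: the physical traction coefficient
    scaled by $\hat J$ is the reference one. Membership in the face ensures $\hat J\ne0$. *)
Lemma face_traction f J k L p : on_face f p ->
  blk_Jhat B f p * (\sum_I \sum_K
    normal B f I p * blk_C B I J K L p * blk_F B p K k) =
  \sum_i nu R f i * cref B i J k L p.
Proof.
move=> fp; have Jhat0 := lt0r_neq0 (blk_Jhat_gt0 B fp).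
rewrite /cref mulr_sumr.
under [RHS]eq_bigr do rewrite mulr_sumr.
rewrite [RHS]exchange_big; apply: eq_bigr => I _ /=.
rewrite mulr_sumr.
under [RHS]eq_bigr do rewrite mulr_sumr.
rewrite [RHS]exchange_big; apply: eq_bigr => K _ /=.
rewrite /normal !mulrA divff // mul1r !(mulr_sumr, mulr_suml).
by apply: eq_bigr => i _; ring.
Qed.

(** Both sides are expanded as diagonal coefficients of [D1 B k]; these are compared pointwise, face
    by face. *)
Lemma boundary_traction J L :
  \sum_i \sum_k
    gdiag (bnd_weight B i) *m gdiag (cref B i J k L) *m D1 B k =
  \sum_f face_mass f *m Trac B f J L.
Proof.
under [RHS]eq_bigr do rewrite Trac_gdiag mulmx_sumr.
rewrite exchange_big [RHS]exchange_big; apply: eq_bigr => k _ /=.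
under [RHS]eq_bigr do rewrite mulmxA face_massE mul_gdiag.
under eq_bigr do rewrite mul_gdiag.
rewrite -!mulmx_suml !sum_gdiag; congr (_ *m _); apply: eq_gdiag => p.
under eq_bigr do rewrite bnd_weight_faces mulr_suml.
rewrite exchange_big; apply: eq_bigr => f _ /=.
case: ifPn => fp; last by rewrite mul0r big1 // => i _; rewrite mulr0 mul0r.
rewrite [X in X * _]mulrC -mulrA face_traction // mulr_sumr.
by apply: eq_bigr => i _; ring.
Qed.

(** The factor $\mathcal J^{-1}$ in [Dvol] cancels, and [Hvol_DD] is then summed over both reference
    indices. *)
Lemma green J L :
  gdiag (blk_J B) *m Hvol B *m Dvol B J L =
  - stiff_tot J L + \sum_f face_mass f *m Trac B f J L.
Proof.
rewrite -boundary_traction /stiff_tot /Dvol mulmx_sumr -sumrN -big_split /=.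
apply: eq_bigr => i _; rewrite mulmx_sumr -sumrN -big_split /=.
apply: eq_bigr => k _; rewrite -Hvol_DD mulmxA; congr (_ *m _).
rewrite Hvol_gdiag !mul_gdiag; apply: eq_gdiag => p.
by rewrite mulrAC divff ?mul1r // lt0r_neq0 // blk_J_gt0.
Qed.

(** Transposition swaps the reference indices, and $C_{IJKL}=C_{KLIJ}$ gives $c_{iJkL}=c_{kLiJ}$. *)
Lemma tr_stiff_tot J L : (stiff_tot J L)^T = stiff_tot L J.
Proof.
rewrite /stiff_tot linear_sum [RHS]exchange_big; apply: eq_bigr => i _ /=.
rewrite linear_sum; apply: eq_bigr => k _ /=; rewrite tr_stiff.
apply: eq_stiff => p; rewrite /cref exchange_big; apply: eq_bigr => I _ /=.
by apply: eq_bigr => K _; rewrite blk_C_sym; ring.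
Qed.

Lemma JHinvK n (x : 'M[R]_(#|G|, n)) :
  gdiag (blk_J B) *m Hvol B *m (JHinv B *m x) = x.
Proof.
rewrite /JHinv mulKVmx // Hvol_gdiag mul_gdiag; apply: gdiag_unit => p.
rewrite mulr_gt0 ?blk_J_gt0 // prodr_gt0 // => j _; exact: sbp_h_gt0.
Qed.

End GreenFormula.

(** * Calculus of bilinear forms given by matrices *)

Section BilinearForm.
Context {R : realFieldType}.

Definition bil m n (A : 'M[R]_(m, n)) (x : 'cV[R]_m) (y : 'cV[R]_n) : R :=
  (x^T *m A *m y) 0 0.

Lemma bil_tr m n (A : 'M[R]_(m, n)) x y : bil A x y = bil A^T y x.
Proof.
have -> : bil A x y = (x^T *m A *m y)^T 0 0 by rewrite mxE.
by rewrite !trmx_mul trmxK mulmxA.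
Qed.

Lemma bil_mulr m n p (A : 'M[R]_(m, n)) (C : 'M[R]_(n, p)) x y :
  bil A x (C *m y) = bil (A *m C) x y.
Proof. by rewrite /bil !mulmxA. Qed.

Lemma bil_mull m n p (A : 'M[R]_(m, n)) (C : 'M[R]_(m, p)) x y :
  bil A (C *m x) y = bil (C^T *m A) x y.
Proof. by rewrite /bil trmx_mul !mulmxA. Qed.

Lemma bilDr m n (A : 'M[R]_(m, n)) x y z :
  bil A x (y + z) = bil A x y + bil A x z.
Proof. by rewrite /bil mulmxDr mxE. Qed.

Lemma bilNr m n (A : 'M[R]_(m, n)) x y : bil A x (- y) = - bil A x y.
Proof. by rewrite /bil mulmxN mxE. Qed.

Lemma bilZr m n (A : 'M[R]_(m, n)) x a y : bil A x (a *: y) = a * bil A x y.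
Proof. by rewrite /bil -scalemxAr mxE. Qed.

Lemma bil_sumr m n (A : 'M[R]_(m, n)) x (I : finType) (y : I -> 'cV[R]_n) :
  bil A x (\sum_i y i) = \sum_i bil A x (y i).
Proof. by rewrite /bil mulmx_sumr summxE. Qed.

Lemma bilDl m n (A : 'M[R]_(m, n)) x y z :
  bil A (x + y) z = bil A x z + bil A y z.
Proof. by rewrite !(bil_tr A) bilDr. Qed.

Lemma bilNl m n (A : 'M[R]_(m, n)) x y : bil A (- x) y = - bil A x y.
Proof. by rewrite !(bil_tr A) bilNr. Qed.

Lemma bil_suml m n (A : 'M[R]_(m, n)) (I : finType) (x : I -> 'cV[R]_m) y :
  bil A (\sum_i x i) y = \sum_i bil A (x i) y.
Proof. by rewrite bil_tr bil_sumr; apply: eq_bigr => i _; rewrite -bil_tr. Qed.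

End BilinearForm.

(** * Energy identity for one block *)

Section Energy.
Context {R : realFieldType} {d N : nat} (B : block R d N).
Local Notation G := (grid d N).
Implicit Types (phi u x : 'I_d -> 'cV[R]_#|G|).

Definition energy phi u : R := \sum_J \sum_L bil (stiff_tot B J L) (phi J) (u L).

Lemma energyC phi u : energy phi u = energy u phi.
Proof.
rewrite /energy exchange_big; apply: eq_bigr => L _; apply: eq_bigr => J _ /=.
by rewrite bil_tr tr_stiff_tot.
Qed.

Lemma ip_bil (a b : 'cV[R]_#|G|) :
  ip B a b = bil (gdiag (blk_J B) *m Hvol B) a b.
Proof. by rewrite /bil mulmxA. Qed.

Lemma ipC (a b : 'cV[R]_#|G|) : ip B a b = ip B b a.
Proof. by rewrite !ip_bil bil_tr Hvol_gdiag mul_gdiag tr_gdiag. Qed.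

(** Here [x] stands for an arbitrary interface penalty before the scaling by $(\mathcal JH)^{-1}$.
    The outer penalties cancel every face term of [green] except that of [gam]. *)
Lemma block_residual gam u x J :
  gdiag (blk_J B) *m Hvol B *m
    (\sum_L Dvol B J L *m u L + JHinv B *m x J + outer_pen B gam u J) =
  - (\sum_L stiff_tot B J L *m u L)
  + (x J + face_mass B gam *m \sum_L Trac B gam J L *m u L).
Proof.
rewrite !mulmxDr /outer_pen mulmxN !JHinvK mulmx_sumr.
under eq_bigr do rewrite mulmxA green mulmxDl mulNmx mulmx_suml.
rewrite big_split /= sumrN exchange_big (bigD1 gam) //= -addrA -!addrA.
congr (_ + _); rewrite addrCA [in RHS]addrC mulmx_sumr.
under [in RHS]eq_bigr do rewrite mulmxA.
rewrite addrCA; congr (_ + _); by rewrite addrCA subrr addr0.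
Qed.

Lemma block_energy gam phi u x :
  \sum_J ip B (phi J)
    (\sum_L Dvol B J L *m u L + JHinv B *m x J + outer_pen B gam u J) =
  - energy phi u + \sum_J bil 1%:M (phi J)
      (x J + face_mass B gam *m \sum_L Trac B gam J L *m u L).
Proof.
rewrite /energy -sumrN -big_split /=; apply: eq_bigr => J _.
(* The weight $\mathcal JH$ is moved onto the second argument, where it meets the operator and
   leaves a form with identity matrix. *)
rewrite ip_bil -[_ *m Hvol B]mul1mx -bil_mulr block_residual [LHS]bilDr bilNr.
congr (- _ + _); rewrite bil_sumr; apply: eq_bigr => L _.
by rewrite bil_mulr mul1mx.
Qed.

End Energy.

(** * Interface penalties and their symmetric coupling form *)

Section Interface.
Context {R : realFieldType} {d N : nat} {Bu Bv : block R d N}.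
Variables (Gam : interface Bu Bv) (h1 beta : R).
Local Notation G := (grid d N).
Local Notation gu := (ifc_u Gam).
Local Notation gv := (ifc_v Gam).
Local Notation eu := (euT Gam).
Local Notation ev := (evT Gam).
Local Notation W := (Jhat_gam Gam *m Hgam Gam).
Local Notation Z := (Zpen Gam h1 beta).
Implicit Types (u v phi chi : 'I_d -> 'cV[R]_#|G|).

Definition trac_u u J := \sum_L eu *m Trac Bu gu J L *m u L.
Definition trac_v v J := \sum_L ev *m Trac Bv gv J L *m v L.

(** The interface SAT of the first block without the common factor $(\mathcal J^uH^u)^{-1}$;
    [flux_v] is its counterpart. *)
Definition flux_u u v J :=
  - (\sum_L eu^T *m Z L J *m W *m jump Gam u v L)
  + 2^-1 *: (\sum_L (Trac Bu gu L J)^T *m eu^T *m W *m jump Gam u v L)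
  - 2^-1 *: (eu^T *m W *m trac_sum Gam u v J).

Definition flux_v u v J :=
  \sum_L ev^T *m Z L J *m W *m jump Gam u v L
  - 2^-1 *: (\sum_L (Trac Bv gv L J)^T *m ev^T *m W *m jump Gam u v L)
  - 2^-1 *: (ev^T *m W *m trac_sum Gam u v J).

Lemma trac_uE u J : trac_u u J = eu *m \sum_L Trac Bu gu J L *m u L.
Proof. by rewrite mulmx_sumr; apply: eq_bigr => L _; rewrite mulmxA. Qed.

Lemma trac_vE v J : trac_v v J = ev *m \sum_L Trac Bv gv J L *m v L.
Proof. by rewrite mulmx_sumr; apply: eq_bigr => L _; rewrite mulmxA. Qed.

Lemma trac_sumE u v J : trac_sum Gam u v J = trac_u u J + trac_v v J.
Proof. exact: big_split. Qed.

Lemma face_mass_u : face_mass Bu gu = eu^T *m W *m eu.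
Proof. by rewrite !mulmxA. Qed.

(** The face term of the second block is rewritten over the points of the first block's face, by the
    bijection [ifc_pt] and the agreement of quadrature and scale factor. *)
Lemma face_mass_v : face_mass Bv gv = ev^T *m W *m ev.
Proof.
rewrite mul_gdiag restr_gdiag /face_mass -(mulmxA _ (Jhat_face _ _)) mul_gdiag.
rewrite restr_gdiag; apply: eq_gdiag => p.
rewrite (reindex (@ifc_pt _ _ _ _ _ Gam)); last exact/onW_bij/ifc_pt_bij.
by apply: eq_bigr => s _; rewrite -ifc_Jhat -ifc_H.
Qed.

Lemma tr_face_quadrature : W^T = W.
Proof. by rewrite mul_gdiag tr_gdiag. Qed.

Lemma nCnC (B : block R d N) f J L p : nCn B f J L p = nCn B f L J p.
Proof.
rewrite /nCn exchange_big; congr (_ / _); apply: eq_bigr => K _ /=.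
by apply: eq_bigr => I _; rewrite blk_C_sym; ring.
Qed.

(** All factors are diagonal, so only $\mathbb Z_{JL}=\mathbb Z_{LJ}$ is at stake, which [nCnC]
    supplies on each side. *)
Lemma tr_ZW J L : (Z J L *m W)^T = Z L J *m W.
Proof.
rewrite !mul_gdiag tr_gdiag; apply: eq_gdiag => s.
by rewrite (nCnC _ _ J) (nCnC Bv _ J).
Qed.

Lemma Dtot_u_flux u v J :
  Dtot_u Gam h1 beta u v J =
  \sum_L Dvol Bu J L *m u L + JHinv Bu *m flux_u u v J + outer_pen Bu gu u J.
Proof.
rewrite /Dtot_u /flux_u !mulmxDr !mulmxN -!scalemxAr !mulmx_sumr !addrA.
by do ![congr (_ + _)| congr (- _) | congr (_ *: _)
       | apply: eq_bigr => L _]; rewrite !mulmxA.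
Qed.

Lemma Dtot_v_flux u v J :
  Dtot_v Gam h1 beta u v J =
  \sum_L Dvol Bv J L *m v L + JHinv Bv *m flux_v u v J + outer_pen Bv gv v J.
Proof.
rewrite /Dtot_v /flux_v !mulmxDr !mulmxN -!scalemxAr !mulmx_sumr !addrA.
by do ![congr (_ + _)| congr (- _) | congr (_ *: _)
       | apply: eq_bigr => L _]; rewrite !mulmxA.
Qed.

Definition coupling phi chi u v : R :=
  - (\sum_J \sum_L bil (Z L J *m W) (jump Gam phi chi J) (jump Gam u v L))
  + 2^-1 * (\sum_J (
      bil W (trac_u phi J - trac_v chi J) (jump Gam u v J)
      + bil W (jump Gam phi chi J) (trac_u u J - trac_v v J))).

Lemma couplingC phi chi u v : coupling phi chi u v = coupling u v phi chi.
Proof.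
rewrite /coupling; congr (- _ + _ * _).
  rewrite exchange_big; apply: eq_bigr => L _; apply: eq_bigr => J _ /=.
  by rewrite bil_tr tr_ZW.
by apply: eq_bigr => J _; rewrite addrC ![bil W _ _ in LHS]bil_tr tr_face_quadrature.
Qed.

(** The transposed-traction penalty, tested against [u], pairs the traction of [u] with [y]; this is
    the mirror image of the traction penalty. *)
Lemma sum_bil_tr_trac (e : 'M[R]_(#|face_pt N gu|, #|G|))
    (T : 'I_d -> 'I_d -> 'M_#|G|) u y :
  \sum_J bil 1%:M (u J) (\sum_L (T L J)^T *m e^T *m W *m y L) =
  \sum_L bil W (\sum_J e *m T L J *m u J) (y L).
Proof.
under eq_bigr do rewrite bil_sumr.
rewrite exchange_big; apply: eq_bigr => L _ /=; rewrite bil_suml.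
by apply: eq_bigr => J _; rewrite bil_mulr mul1mx bil_mull trmx_mul.
Qed.

Lemma sum_bil_Z (e : 'M[R]_(#|face_pt N gu|, #|G|)) u y :
  \sum_J bil 1%:M (u J) (\sum_L e^T *m Z L J *m W *m y L) =
  \sum_J \sum_L bil (Z L J *m W) (e *m u J) (y L).
Proof.
apply: eq_bigr => J _; rewrite bil_sumr; apply: eq_bigr => L _.
by rewrite bil_mulr mul1mx bil_mull !mulmxA.
Qed.

Lemma bil_lift (e : 'M[R]_(#|face_pt N gu|, #|G|)) x y :
  bil 1%:M x (e^T *m W *m y) = bil W (e *m x) y.
Proof. by rewrite bil_mulr mul1mx bil_mull. Qed.

(** Subtracting half of $\tau^u+\tau^v$ from the traction left by Green's formula gives
    $\pm\frac12(\tau^u-\tau^v)$ on the two sides. The opposite signs combine the two test functions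
    into their jump. *)
Lemma interface_terms phi chi u v :
  \sum_J bil 1%:M (phi J)
    (flux_u u v J + face_mass Bu gu *m \sum_L Trac Bu gu J L *m u L)
  + \sum_J bil 1%:M (chi J)
    (flux_v u v J + face_mass Bv gv *m \sum_L Trac Bv gv J L *m v L)
  = coupling phi chi u v.
Proof.
(* Both sides share this shape: [s] is the traction sum, [e *m t] the own traction, and [x] the
   penalties acting on the jump. *)
have flux (e : 'M[R]_(#|face_pt N gu|, #|G|)) a x s t M :
    M = e^T *m W *m e ->
    bil 1%:M a (x - 2^-1 *: (e^T *m W *m s) + M *m t) =
    bil 1%:M a x + bil W (e *m a) (e *m t - 2^-1 *: s).
  move=> ->; rewrite -bil_lift [_ *m (_ - _)]mulmxDr mulmxN -scalemxAr mulmxA.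
  by rewrite -bilDr !mulmxA -addrA (addrC (- _)).
under eq_bigr do rewrite (flux eu) ?face_mass_u //.
under [X in _ + X]eq_bigr do rewrite (flux ev) ?face_mass_v //.
rewrite !big_split /=.
under eq_bigr do rewrite bilDr bilNr bilZr.
under [X in _ + (X + _)]eq_bigr do rewrite bilDr bilNr bilZr.
rewrite !big_split /= !sumrN -!mulr_sumr !sum_bil_Z !sum_bil_tr_trac.
rewrite /coupling !mulr_sumr -!sumrN -!big_split /=; apply: eq_bigr => J _.
(* The test jump is split to match the separate contributions of the two blocks. *)
have -> : \sum_L bil (Z L J *m W) (jump Gam phi chi J) (jump Gam u v L) =
    \sum_L bil (Z L J *m W) (eu *m phi J) (jump Gam u v L)
    - \sum_L bil (Z L J *m W) (ev *m chi J) (jump Gam u v L).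
  by rewrite -sumrB; apply: eq_bigr => L _; rewrite bilDl bilNl.
rewrite -trac_uE -trac_vE trac_sumE -/(trac_u phi J) -/(trac_v chi J).
rewrite [jump Gam phi chi J]/jump.
rewrite !(bilDr, bilDl, bilNl, bilNr, bilZr).
by field.
Qed.

End Interface.

Unset Implicit Arguments.

(** * Self-adjointness of the coupled operator *)

Theorem theorem5 (R : realFieldType) (d N : nat) (hN : (0 < N)%N)
    (Bu Bv : block R d N) (Gam : interface Bu Bv) (h1 beta : R)
    (h1u : forall i : 'I_d, sbp_h (blk_sbp Bu i) 0 ord0 = h1)
    (h1v : forall i : 'I_d, sbp_h (blk_sbp Bv i) 0 ord0 = h1)
    (hbeta : 1 <= beta) :
  forall psi w : 'I_d -> 'cV[R]_(#|grid d N| + #|grid d N|),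
    ip_tot Bu Bv psi (Dtot Gam h1 beta w) =
    ip_tot Bu Bv (Dtot Gam h1 beta psi) w.
Proof.
(* Each of the three terms on the right is symmetric under exchange of [psi] and [w]. *)
have form psi w : ip_tot Bu Bv psi (Dtot Gam h1 beta w) =
    - energy Bu (fun J => usubmx (psi J)) (fun J => usubmx (w J))
    - energy Bv (fun J => dsubmx (psi J)) (fun J => dsubmx (w J))
    + coupling Gam h1 beta (fun J => usubmx (psi J)) (fun J => dsubmx (psi J))
        (fun J => usubmx (w J)) (fun J => dsubmx (w J)).
  rewrite /ip_tot /Dtot.
  under eq_bigr do rewrite col_mxKu Dtot_u_flux.
  under [X in _ + X]eq_bigr do rewrite col_mxKd Dtot_v_flux.
  by rewrite !block_energy addrACA interface_terms.
(* Symmetry of the inner product puts the operator in the second slot, so [form] applies to both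
   sides. *)
move=> psi w; have -> : ip_tot Bu Bv (Dtot Gam h1 beta psi) w =
    ip_tot Bu Bv w (Dtot Gam h1 beta psi).
  by congr (_ + _); apply: eq_bigr => J _; rewrite ipC.
by rewrite !form energyC (energyC Bv) couplingC.
Qed.
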